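(* Let $A=(a_\alpha^\beta)_{\alpha,\beta=1,2,3}$ be a generic nonsingular $3\times 3$ real matrix (lower index = row, upper index = column), and let $B=(b_\alpha^\beta)=A^{-1}$. Let $(x^1,x^2,x^3,y_4,y_5,y_6)$ be the standard linear coordinates on $\mathbb{R}^6$, and define linear functions $x^4,x^5,x^6,y_1,y_2,y_3$ on $\mathbb{R}^6$ by $$x^{3+\alpha}=\sum_{\beta=1}^3 a_\beta^\alpha x^\beta,\qquad y_{3+\alpha}=-\sum_{\beta=1}^3 b_\alpha^\beta y_\beta\qquad(\alpha=1,2,3),$$ the second relation being equivalent to $y_\alpha=-\sum_{\beta} a_\alpha^\beta y_{3+\beta}$. Consider the $6$-web $W(6,3,2)$ on $\mathbb{R}^6$ whose $\xi$-th foliation $X_\xi$ is given by $dx^\xi=0,\ dy_\xi=0$ (i.e. its leaves are $\{x^\xi=\mathrm{const},\ y_\xi=\mathrm{const}\}$), $\xi=1,\dots,6$. Then this $6$-web is not almost Grassmannizable. Here ''generic'' means: there is a nonzero real polynomial $P$ in the nine entries of $A$ such that the assertion holds (including that the six foliations do form a web $W(6,3,2)$) for every nonsingular $A$ with $P(A)\neq 0$.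
   Context: A $6$-web $W(6,3,2)$ of codimension two on an open domain $D$ of a $6$-dimensional differentiable manifold is given by six foliations $X_1,\dots,X_6$ of $D$ of codimension two such that at each point of $D$ the six tangent $4$-planes to the leaves are in general position. General position means: if the tangent $4$-plane of the $\xi$-th leaf is the common kernel of two linearly independent $1$-forms $\omega_\xi^1,\omega_\xi^2$, then for any three distinct indices $\xi,\eta,\zeta$ the six forms $\omega_\xi^i,\omega_\eta^i,\omega_\zeta^i$ ($i=1,2$) are linearly independent. Two webs $W(6,3,2)$ and $\widetilde W(6,3,2)$ are equivalent if there is a local diffeomorphism of their domains carrying the foliations of one into the foliations of the other. Segre cone of a $4$-subweb: for $a\in\{4,5,6\}$, consider the $4$-subweb $[a,1,2,3]$ formed by $X_1,X_2,X_3,X_a$. At a point $p$ one can choose bases $\omega_\xi^1,\omega_\xi^2$ of the annihilators of the tangent $4$-planes of the leaves ($\xi=1,2,3,a$) so that $-\omega_a^i=\omega_1^i+\omega_2^i+\omega_3^i$, $i=1,2$. The Segre cone at $p$ defined by $[a,1,2,3]$ is the set of tangent vectors $v$ for which the $3\times2$ matrix $(\omega_\alpha^i(v))_{\alpha=1,2,3;\,i=1,2}$ has rank at most $1$; this does not depend on the choices. An almost Grassmann structure on a $6$-manifold is a smooth field of such Segre cones (cones over the Segre variety $\mathbb{P}^1\times\mathbb{P}^2\subset\mathbb{P}^5$) in its tangent spaces, so each subweb $[a,1,2,3]$ defines one. A web $W(6,3,2)$ is an almost Grassmann web if the three almost Grassmann structures defined by the subwebs $[4,1,2,3]$, $[5,1,2,3]$,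 $[6,1,2,3]$ coincide. A web is almost Grassmannizable if it is equivalent to an almost Grassmann web. *)

(* Defs.v *)
(* MathComp-Analysis; the real numbers are an arbitrary R : realType. *)
From HB Require Import structures.
From mathcomp Require Import all_boot all_order all_fingroup all_algebra.
From mathcomp Require Import all_classical all_reals all_analysis.

Set Implicit Arguments.
Unset Strict Implicit.
Unset Printing Implicit Defensive.
Import Order.TTheory GRing.Theory Num.Theory.
Import numFieldNormedType.Exports.
Local Open Scope classical_set_scope.
Local Open Scope ring_scope.

(* C^k on S, for S open: all iterated directional derivatives up to order k
   exist and are continuous at every point of S. *)
Fixpoint Ck (R : realType) (m n : nat) (k : nat) (S : set 'rV[R]_m)
    (f : 'rV[R]_m -> 'rV[R]_n) : Prop :=
  if k is k'.+1 then
    (forall x, S x -> differentiable f x) /\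
    (forall v, Ck k' S (fun x => 'D_v f x))
  else forall x, S x -> {for x, continuous f}.

Definition smooth_on (R : realType) (m n : nat) (S : set 'rV[R]_m)
    (f : 'rV[R]_m -> 'rV[R]_n) : Prop := forall k, Ck k S f.

(* [chart_to] is meaningful on [chart_dom] only, and [chart_from] on the image
   of [chart_dom] only. *)
Record chart (R : realType) (n : nat) (T : topologicalType) := Chart {
  chart_dom : set T;
  chart_to : T -> 'rV[R]_n;
  chart_from : 'rV[R]_n -> T
}.

Definition chart_homeo (R : realType) (n : nat) (T : topologicalType)
    (c : chart R n T) : Prop :=
  [/\ open (chart_dom c),
      open (chart_to c @` chart_dom c),
      forall p, chart_dom c p -> chart_from c (chart_to c p) = p,
      forall p, chart_dom c p -> {for p, continuous (chart_to c)} &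
      forall x, (chart_to c @` chart_dom c) x ->
        {for x, continuous (chart_from c)}].

Record manifold (R : realType) (n : nat) := Manifold {
  carrier :> topologicalType;
  atlas : set (chart R n carrier);
  manifold_hausdorff : hausdorff_space carrier;
  manifold_countable : @second_countable carrier;
  atlas_homeo : forall c, atlas c -> chart_homeo c;
  atlas_cover : forall p : carrier, exists2 c, atlas c & chart_dom c p;
  atlas_smooth : forall c c', atlas c -> atlas c' ->
    smooth_on (chart_to c @` (chart_dom c `&` chart_dom c'))
      (chart_to c' \o chart_from c)
}.

Section Euclid.
Variables (R : realType) (n : nat).

Lemma euclid_hausdorff : hausdorff_space 'rV[R]_n.
Proof. exact: norm_hausdorff. Qed.

Lemma euclid_countable : @second_countable 'rV[R]_n.
Proof.
pose b (u : 'rV[rat]_n * rat) : set 'rV[R]_n :=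
  ball (map_mx ratr u.1 : 'rV[R]_n) (ratr u.2).
exists (range b); first exact: (sub_countable (card_image_le _ _)).
split; first by move=> _ [u _ <-]; exact: ball_open.
move=> x U /nbhs_ballP[e /= e0 xeU].
have [r /andP[r0 re]] : exists r : rat, 0 < (ratr r : R) < e / 2.
  have /rat_in_itvoo[r] : 0 < e / 2 by rewrite divr_gt0.
  by rewrite in_itv /= => h; exists r.
have hq i : exists q : rat, `|ratr q - x 0 i| < ratr r.
  have /rat_in_itvoo[q] : x 0 i - ratr r < x 0 i + ratr r.
    by rewrite ltrBlDr -addrA ltrDl addr_gt0.
  rewrite in_itv /= => /andP[h1 h2]; exists q.
  by rewrite distrC ltr_distlC h1.
have [q qP] := choice hq.
have qx : ball (map_mx ratr (\row_i q i) : 'rV[R]_n) (ratr r) x.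
  by split=> // i j; rewrite !mxE ord1; exact: qP.
exists (b (\row_i q i, r)).
  by split=> //; exists (\row_i q i, r).
move=> y /= yb; apply: xeU.
rewrite (splitr e).
have cx := le_ball (ltW re) (ball_sym qx).
exact: (ball_triangle cx (le_ball (ltW re) yb)).
Qed.

Let euclid_chart : chart R n 'rV[R]_n := Chart setT id id.

Lemma euclid_homeo c : [set euclid_chart] c -> chart_homeo c.
Proof.
move=> ->; split=> //=; rewrite ?image_id; try exact: openT.
  by move=> p _; exact: cvg_id.
by move=> x _; exact: cvg_id.
Qed.

Lemma euclid_cover (p : 'rV[R]_n) :
  exists2 c, [set euclid_chart] c & chart_dom c p.
Proof. by exists euclid_chart. Qed.

Lemma smooth_cst (S : set 'rV[R]_n) (v : 'rV[R]_n) : smooth_on S (fun=> v).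
Proof.
move=> k; elim: k v => [|k IHk] v /=.
  by move=> x _; exact: cst_continuous.
split=> [x _|w]; first exact: differentiable_cst.
have -> : (fun x : 'rV[R]_n => 'D_w (fun=> v) x) = (fun=> 0).
  by apply/funext => x; exact: derive_cst.
exact: IHk.
Qed.

Lemma euclid_smooth c c' : [set euclid_chart] c -> [set euclid_chart] c' ->
  smooth_on (chart_to c @` (chart_dom c `&` chart_dom c'))
    (chart_to c' \o chart_from c).
Proof.
move=> -> -> [|k] /=; first by move=> x _; exact: cvg_id.
split=> [x _|v]; first exact: ex_diff.
have -> : (fun x : 'rV[R]_n => 'D_v (id \o id) x) = (fun=> v).
  by apply/funext => x; exact: derive_id.
exact: smooth_cst.
Qed.

Definition euclid : manifold R n :=
  Manifold euclid_hausdorff euclid_countable euclid_homeo euclid_cover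
    euclid_smooth.

End Euclid.
Arguments euclid : clear implicits.

(* U is meant to be open. *)
Definition smooth_map (R : realType) (m n : nat) (M : manifold R m)
    (N : manifold R n) (U : set M) (phi : M -> N) : Prop :=
  (forall p, U p -> {for p, continuous phi}) /\
  forall (c : chart R m M) (c' : chart R n N), atlas c -> atlas c' ->
    smooth_on
      (chart_to c @` (U `&` chart_dom c `&` (phi @^-1` chart_dom c')))
      (chart_to c' \o phi \o chart_from c).

Definition diffeo (R : realType) (n : nat) (M N : manifold R n)
    (U : set M) (phi : M -> N) : Prop :=
  exists psi : N -> M,
    [/\ open U, open (phi @` U), smooth_map U phi,
        smooth_map (phi @` U) psi & forall p, U p -> psi (phi p) = p].

Section Webs.
Variables (R : realType) (M : manifold R 6).

(* (U, f) belongs to a family of local submersions: U is open and the fibres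
   of f : U -> R^2 are the leaves in U. *)
Definition local_leaves := (set M * (M -> euclid R 2))%type.

(* The differential of f at p as a 6 x 2 matrix acting on row vectors, read in
   the chart c around p. *)
Definition chart_diff (c : chart R 6 M) (f : M -> euclid R 2) (p : M) :
    'M[R]_(6, 2) :=
  'J (f \o chart_from c) (chart_to c p).

Definition submersion (U : set M) (f : M -> euclid R 2) : Prop :=
  smooth_map U f /\
  forall (c : chart R 6 M) p, atlas c -> U p -> chart_dom c p ->
    \rank (chart_diff c f p) = 2%N.

(* f and g define the same leaves near every point of W: locally they differ
   by a diffeomorphism of open subsets of R^2. *)
Definition same_leaves (W : set M) (f g : M -> euclid R 2) : Prop :=
  forall p, W p -> exists (N : set (euclid R 2)) (h : euclid R 2 -> euclid R 2),
    [/\ N (g p), diffeo N h & \forall q \near p, f q = h (g q)].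

(* A foliation of codimension two of the open set D, given by a covering family
   of compatible local submersions onto open subsets of R^2. *)
Definition foliation (D : set M) (F : set local_leaves) : Prop :=
  [/\ forall U f, F (U, f) -> [/\ open U, U `<=` D & submersion U f],
      forall p, D p -> exists U f, F (U, f) /\ U p &
      forall U f V g, F (U, f) -> F (V, g) -> same_leaves (U `&` V) f g].

(* Tangent vectors at p are read as rows of components in the chart c. *)
Definition tangent_plane (F : set local_leaves) (c : chart R 6 M) (p : M) :
    set 'rV[R]_6 :=
  [set v : 'rV[R]_6 | exists U f, [/\ F (U, f), U p & v *m chart_diff c f p = 0]].

(* The two columns of Om are linearly independent 1-forms whose common kernel
   is T. *)
Definition annihilator_basis (T : set 'rV[R]_6) (Om : 'M[R]_(6, 2)) : Prop :=
  \rank Om = 2%N /\ forall v, T v <-> v *m Om = 0.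

Definition general_position (F : 'I_6 -> set local_leaves) (c : chart R 6 M)
    (p : M) : Prop :=
  forall i j k : 'I_6, i != j -> i != k -> j != k ->
  forall Oi Oj Ok : 'M[R]_(6, 2),
    annihilator_basis (tangent_plane (F i) c p) Oi ->
    annihilator_basis (tangent_plane (F j) c p) Oj ->
    annihilator_basis (tangent_plane (F k) c p) Ok ->
    \rank (row_mx Oi (row_mx Oj Ok)) = 6%N.

Definition web (D : set M) (F : 'I_6 -> set local_leaves) : Prop :=
  [/\ open D, forall i, foliation D (F i) &
      forall (c : chart R 6 M) p, atlas c -> D p -> chart_dom c p ->
        general_position F c p].

(* Foliations are numbered from 0: [lshift 3 i] is X_(i+1), i < 3, and
   [rshift 3 k] is X_(k+4), k < 3.  This is the cone of [k+4, 1, 2, 3]. *)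
Definition segre_cone (F : 'I_6 -> set local_leaves) (k : 'I_3)
    (c : chart R 6 M) (p : M) : set 'rV[R]_6 :=
  [set v : 'rV[R]_6 | exists (Om : 'I_3 -> 'M[R]_(6, 2)) (Oa : 'M[R]_(6, 2)),
    [/\ forall i : 'I_3,
          annihilator_basis (tangent_plane (F (lshift 3 i)) c p) (Om i),
        annihilator_basis (tangent_plane (F (rshift 3 k)) c p) Oa,
        - Oa = \sum_(i < 3) Om i &
        (\rank (\matrix_(i < 3, j < 2) (v *m Om i) 0 j)%R <= 1)%N]].

Definition almost_grassmann (D : set M) (F : 'I_6 -> set local_leaves) : Prop :=
  forall (c : chart R 6 M) p, atlas c -> D p -> chart_dom c p ->
  forall k l : 'I_3, segre_cone F k c p = segre_cone F l c p.

End Webs.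

(* On U, the foliation F is the pull-back by phi of the foliation F'. *)
Definition carries (R : realType) (M N : manifold R 6) (U : set M)
    (phi : M -> N) (F : set (local_leaves M)) (F' : set (local_leaves N)) :
    Prop :=
  forall V f V' g, F (V, f) -> F' (V', g) ->
    same_leaves (U `&` V `&` (phi @^-1` V')) f (g \o phi).

(* Equivalence is local (a diffeomorphism between nonempty open subsets of the
   domains), and the foliations may be renumbered. *)
Definition web_equiv (R : realType) (M N : manifold R 6)
    (D : set M) (F : 'I_6 -> set (local_leaves M))
    (D' : set N) (F' : 'I_6 -> set (local_leaves N)) : Prop :=
  exists (U : set M) (phi : M -> N) (s : {perm 'I_6}),
    [/\ U !=set0, U `<=` D, phi @` U `<=` D', diffeo U phi &
        forall i, carries U phi (F i) (F' (s i))].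

Definition almost_grassmannizable (R : realType) (M : manifold R 6)
    (D : set M) (F : 'I_6 -> set (local_leaves M)) : Prop :=
  exists (N : manifold R 6) (D' : set N) (F' : 'I_6 -> set (local_leaves N)),
    [/\ web D' F', almost_grassmann D' F' & web_equiv D F D' F'].

(* A point p of R^6 has coordinates (x^1, x^2, x^3, y_4, y_5, y_6). *)
Definition web_x (R : realType) (A : 'M[R]_3) (xi : 'I_6)
    (p : 'rV[R]_(3 + 3)) : R :=
  match fintype.split (xi : 'I_(3 + 3)) with
  | inl i => p 0 (lshift 3 i)
  | inr i => \sum_(j < 3) A j i * p 0 (lshift 3 j)
  end.

Definition web_y (R : realType) (A : 'M[R]_3) (xi : 'I_6)
    (p : 'rV[R]_(3 + 3)) : R :=
  match fintype.split (xi : 'I_(3 + 3)) with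
  | inl i => - \sum_(j < 3) A i j * p 0 (rshift 3 j)
  | inr i => p 0 (rshift 3 i)
  end.

(* y_1, y_2, y_3 are determined by this relation, in terms of B = A^-1. *)
Lemma web_yE (R : realType) (A : 'M[R]_3) (p : 'rV[R]_(3 + 3)) (i : 'I_3) :
  A \in unitmx ->
  web_y A (rshift 3 i) p =
    - \sum_(j < 3) invmx A i j * web_y A (lshift 3 j) p.
Proof.
move=> uA; rewrite /web_y (unsplitK (inr i : 'I_3 + 'I_3)).
pose y : 'cV[R]_3 := \col_j p 0 (rshift 3 j).
have yE : y = - (invmx A *m - (A *m y)) by rewrite mulmxN opprK mulKmx.
have := congr1 (fun z : 'cV[R]_3 => z i 0) yE; rewrite /y !mxE => ->.
congr (- _); apply: eq_bigr => j _; rewrite !mxE.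
rewrite (unsplitK (inl j : 'I_3 + 'I_3)); congr (_ * - _).
by apply: eq_bigr => k _; rewrite !mxE.
Qed.

(* One global submersion (x^xi, y_xi) for each foliation. *)
Definition linear_web (R : realType) (A : 'M[R]_3) (xi : 'I_6) :
    set (local_leaves (euclid R 6)) :=
  [set (setT, fun p : euclid R 6 =>
    \row_(j < 2) (if j == 0 then web_x A xi p else web_y A xi p))].

(* Main.v *)
Require Import Defs.
From mathcomp Require Import all_boot all_order all_fingroup all_algebra.
From mathcomp Require Import all_classical all_reals all_analysis.
(* Not fully imported: mpoly's notations clash with those of MathComp-Analysis. *)
From mathcomp Require mpoly.
Import (canonicals) mpoly.
From mathcomp Require Import ring lra.

(** The web is translation invariant, so everything happens in one cotangent
    space.  The leaf xi has conormal plane spanned by a form u_xi in the dx's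
    and a form w_xi in the dy's.  The six vectors u_xi are the columns of
    U = (1 | A), the six vectors w_xi those of W = (- A^T | 1), and
    U W^T = 0: the second configuration is the Gale dual of the first.

    Choose three foliations as a base and let a be one of the other three.
    Then u_a = sum_i C_ia u_i and w_a = sum_i D_ia w_i over the base, and the
    Segre cone of the corresponding 4-subweb consists of the v for which the
    3 x 2 matrix with rows (C_ia u_i(v), D_ia w_i(v)) has rank at most one
    ([segre_coneI], [segre_coneE]).  As the u_i, w_i of the base are
    coordinates, one can solve u_i(v) = D_ia, w_i(v) = C_ia, which makes both
    columns equal.  This v is in the cone of a second subweb, with b in place
    of a, only if D_ia C_ib / (C_ia D_ib) does not depend on i
    ([segre_cone_eq]).  Gale duality gives D = - (C^-1)^T ([ytop_ycoeff]), so
    the coincidence of the cones is a polynomial equation on C.  In brackets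
    it reads [b12][0bc][1ac][0a2] = [0b2][1bc][0ac][a12], where 0, 1, 2 is the
    base and c the third of the remaining indices: the six points u_xi of the
    projective plane lie on a conic.  Orthogonal matrices A satisfy it for the
    base 1, 2, 3, so genericity cannot be omitted.

    An equivalence of webs is differentiated at one point.  By the chain rule
    the form matrix of each leaf of the linear web is Phi G H, with Phi the
    Jacobian of the diffeomorphism, G that of a local submersion of the other
    web and H that of a change of parameters on the plane
    ([pulled_back_jacobian]).  Hence the tangent planes of the other web are,
    up to the invertible Phi, those of the linear web, and the previous
    paragraph applies.  The foliations may be renumbered, so the base can be
    any three of the six.

    Accordingly P is a product over all permutations of the six indices
    ([genericity_at]).  As polynomials over a field form an integral domain,
    P is nonzero once each factor is nonzero at some matrix, and the matrix
    may depend on the permutation.  Six points of the cuspidal cubic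
    (1, t, t^3) with distinct parameters t >= 0 supply one: no three are
    collinear and they are not on a conic ([exists_generic_at]). *)

Set Implicit Arguments.
Unset Strict Implicit.
Unset Printing Implicit Defensive.
Import Order.TTheory GRing.Theory Num.Theory.
Import numFieldNormedType.Exports.
Local Open Scope classical_set_scope.
Local Open Scope ring_scope.

(** * Six vectors of a space and their Gale duals *)

Section Configuration.
Variable S : comNzRingType.
Implicit Types (A B C : 'M[S]_3) (s : 'S_(3 + 3)).

Definition xframe A : 'M[S]_(3, 3 + 3) := row_mx 1%:M A.
Definition yframe A : 'M[S]_(3, 3 + 3) := row_mx (- A^T) 1%:M.

Definition xbase A s := lsubmx (col_perm s (xframe A)).
Definition xtop A s := rsubmx (col_perm s (xframe A)).

(** With C the coefficients of the last three vectors in the basis of the first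
    three and B a multiple of C^-1, the product says that the coefficients over
    the base of the first of them, in both configurations, are nonzero, and the
    difference is the equation of a conic through the six points. *)
Definition defect C B : S :=
  (\prod_i (C i 0 * B 0 i)) *
  (C 0 1 * C 1 0 * B 0 0 * B 1 1 - C 0 0 * C 1 1 * B 0 1 * B 1 0).

(** The coefficient matrix is (xbase A s)^-1 *m xtop A s; the adjugates, in place
    of inverses, keep this polynomial in the entries of A. *)
Definition genericity_at A s : S :=
  let C := \adj (xbase A s) *m xtop A s in
  \det (xbase A s) * \det (xtop A s) * defect C (\adj C).

Lemma frame_mul A : xframe A *m (yframe A)^T = 0.
Proof.
by rewrite tr_row_mx mul_row_col mul1mx trmx1 mulmx1 linearN /= trmxK addNr.
Qed.

Lemma defectZ (a b : S) C B :
  defect (a *: C) (b *: B) = a ^+ 5 * b ^+ 5 * defect C B.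
Proof. rewrite /defect !big_ord_recl !big_ord0 !mxE; ring. Qed.

End Configuration.

Lemma map_defect (S T : comNzRingType) (f : {rmorphism S -> T}) (C B : 'M[S]_3) :
  defect (map_mx f C) (map_mx f B) = f (defect C B).
Proof.
rewrite /defect rmorphM rmorph_prod rmorphB !rmorphM !mxE.
by congr (_ * _); apply: eq_bigr => i _; rewrite rmorphM !mxE.
Qed.

Lemma map_genericity_at (S T : comNzRingType) (f : {rmorphism S -> T})
    (A : 'M[S]_3) s :
  genericity_at (map_mx f A) s = f (genericity_at A s).
Proof.
rewrite /genericity_at.
have -> : xbase (map_mx f A) s = map_mx f (xbase A s).
  by rewrite /xbase map_lsubmx map_col_perm map_row_mx map_mx1.
have -> : xtop (map_mx f A) s = map_mx f (xtop A s).
  by rewrite /xtop map_rsubmx map_col_perm map_row_mx map_mx1.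
by rewrite -map_mx_adj -map_mxM -map_mx_adj map_defect !det_map_mx !rmorphM.
Qed.

Section Generic.
Variable F : fieldType.
Implicit Types (A C : 'M[F]_3) (s : 'S_(3 + 3)).

Definition xcoeff A s := invmx (xbase A s) *m xtop A s.

Definition generic_at A s :=
  [/\ xbase A s \in unitmx, xtop A s \in unitmx &
      defect (xcoeff A s) (invmx (xcoeff A s)) != 0].

(** Passing from inverses to adjugates rescales C and B by nonzero factors, and
    [defect] is homogeneous in each. *)
Lemma genericity_atP A s : genericity_at A s != 0 <-> generic_at A s.
Proof.
have adjE (C : 'M[F]_3) : C \in unitmx -> \adj C = \det C *: invmx C.
  move=> uC; rewrite /invmx uC scalerA mulfV ?scale1r //.
  by rewrite -unitfE -unitmxE.
rewrite /genericity_at /generic_at.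
set q := defect _ (\adj _).
rewrite mulf_eq0 mulf_eq0 !negb_or -!(unitfE (\det _)).
rewrite -!unitmxE /q {q}.
case ub: (_ \in unitmx) => /=; last by split=> // -[].
case ut: (_ \in unitmx) => /=; last by split=> // -[].
suff -> : defect (\adj (xbase A s) *m xtop A s)
      (\adj (\adj (xbase A s) *m xtop A s)) != 0 =
    (defect (xcoeff A s) (invmx (xcoeff A s)) != 0).
  by split=> [h|[_ _ h]]; [split|].
have d0 : \det (xbase A s) != 0 by rewrite -unitfE -unitmxE.
have uC : xcoeff A s \in unitmx by rewrite unitmx_mul unitmx_inv ub.
have uZ : \det (xbase A s) *: xcoeff A s \in unitmx by rewrite unitmxZ ?unitfE.
have e0 : \det (\det (xbase A s) *: xcoeff A s) != 0 by rewrite -unitfE -unitmxE.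
rewrite [\adj (xbase A s)]adjE // -scalemxAl -/(xcoeff A s) adjE // invmxZ //.
rewrite scalerA defectZ; move: (defect _ _) => q.
by rewrite !mulf_eq0 invr_eq0 (negPf d0) (negPf e0).
Qed.

Definition ycoeff A s : 'M[F]_3 := - (invmx (xcoeff A s))^T.

Definition ybase A s := lsubmx (col_perm s (yframe A)).

Section AtPerm.
Variables (A : 'M[F]_3) (s : 'S_(3 + 3)).
Hypotheses (ub : xbase A s \in unitmx) (ut : xtop A s \in unitmx).

Lemma xcoeff_unit : xcoeff A s \in unitmx.
Proof. by rewrite unitmx_mul unitmx_inv ub. Qed.

Lemma xtop_xcoeff : xtop A s = xbase A s *m xcoeff A s.
Proof. by rewrite mulKVmx. Qed.

(** Gale duality.  Over the base, the relations U W^T = 0 read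
    Wbase^T + C Wtop^T = 0, so that the coefficient matrix of the second
    configuration is - (C^-1)^T. *)
Lemma ytop_ycoeff : rsubmx (col_perm s (yframe A)) = ybase A s *m ycoeff A s.
Proof.
have : col_perm s (xframe A) *m (col_perm s (yframe A))^T = 0.
  rewrite tr_col_perm mul_row_perm -col_permM.
  by rewrite mulVg col_perm1 frame_mul.
rewrite -[col_perm s (xframe A)]hsubmxK -[col_perm s (yframe A)]hsubmxK.
rewrite tr_row_mx mul_row_col row_mxKr -/(ybase A s) -/(xbase A s) -/(xtop A s).
rewrite xtop_xcoeff -mulmxA -mulmxDr.
move/(congr1 (mulmx (invmx (xbase A s)))); rewrite mulmx0 mulKmx //.
move/addr0_eq => h; apply: trmx_inj.
rewrite trmx_mul /ycoeff linearN /= trmxK -[(ybase A s)^T]opprK h.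
by rewrite mulNmx mulmxN opprK mulKmx // xcoeff_unit.
Qed.

(** A combination y of the rows of W that vanishes on the base vanishes on the
    other three columns as well, hence on all of W, which contains the
    identity. *)
Lemma ybase_unit : ybase A s \in unitmx.
Proof.
rewrite -row_free_unit; apply: inj_row_free => y y0.
have : y *m col_perm s (yframe A) = 0.
  rewrite -[col_perm s (yframe A)]hsubmxK mul_mx_row ytop_ycoeff mulmxA.
  by rewrite -/(ybase A s) y0 mul0mx row_mx0.
move/(congr1 (mulmx^~ (perm_mx s))).
rewrite col_permE -!mulmxA -perm_mxM mulVg perm_mx1 mulmx1 mul0mx.
by rewrite mul_mx_row mulmx1 -[0]hsubmxK => /eq_row_mx[_ ->]; rewrite linear0.
Qed.

End AtPerm.

(** Its two columns are the forms dx^xi and dy_xi on rows of coordinates. *)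
Definition leaf_form A (xi : 'I_(3 + 3)) : 'M[F]_(3 + 3, 1 + 1) :=
  block_mx (col xi (xframe A)) 0 0 (col xi (yframe A)).

Lemma mul_col_lsubmx s (U : 'M[F]_(3, 3 + 3)) (x : 'rV[F]_3) i :
  x *m col (s (lshift 3 i)) U = col i (x *m lsubmx (col_perm s U)).
Proof.
have -> : col (s (lshift 3 i)) U = col i (lsubmx (col_perm s U)).
  by apply/colP => r; rewrite !mxE.
by rewrite !colEsub mulmx_colsub.
Qed.

Lemma mul_leaf_form A xi (x y : 'rV[F]_3) :
  row_mx x y *m leaf_form A xi =
    row_mx (x *m col xi (xframe A)) (y *m col xi (yframe A)).
Proof. by rewrite mul_row_block !mulmx0 addr0 add0r. Qed.

(** The forms of the base leaves are linear coordinates, because both blocks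
    xbase and ybase of their matrix are invertible. *)
Lemma leaf_form_dual A s (z : 'I_3 -> 'rV[F]_(1 + 1)) :
  xbase A s \in unitmx -> xtop A s \in unitmx ->
  exists v, forall i, v *m leaf_form A (s (lshift 3 i)) = z i.
Proof.
move=> ub ut; have uy := ybase_unit ub ut.
pose x := (\row_i lsubmx (z i) 0 0) *m invmx (xbase A s).
pose y := (\row_i rsubmx (z i) 0 0) *m invmx (ybase A s).
exists (row_mx x y) => i; rewrite mul_leaf_form !mul_col_lsubmx -[z i]hsubmxK.
by congr row_mx; rewrite mulmxKV //; apply/rowP => j; rewrite !mxE ord1.
Qed.

Definition nondegenerate_frames A :=
  forall s, xbase A s \in unitmx /\ xtop A s \in unitmx.

(** Every leaf belongs to some base, and the coordinates of a base are
    independent. *)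
Lemma leaf_form_rank A xi :
  nondegenerate_frames A -> \rank (leaf_form A xi) = 2%N.
Proof.
move=> gA; pose s : 'S_(3 + 3) := tperm (lshift 3 0) xi.
have [ub ut] := gA s.
apply/eqP; rewrite -[_ == _]/(row_full _) -sub1mx; apply/row_subP => j.
have [v vE] := leaf_form_dual (fun=> row j 1%:M) ub ut.
by rewrite -(vE 0) tpermL submxMl.
Qed.

Lemma perm_of_triple (i j k : 'I_(3 + 3)) : i != j -> i != k -> j != k ->
  exists s : 'S_(3 + 3),
    [/\ s (lshift 3 0) = i, s (lshift 3 1) = j & s (lshift 3 2%:R) = k].
Proof.
move=> ij ik jk; pose t3 := [:: i; j; k].
pose t := t3 ++ [seq x <- enum 'I_(3 + 3) | x \notin t3].
have ut : uniq t.
  rewrite cat_uniq filter_uniq ?enum_uniq //= !inE !negb_or ij ik jk /= andbT.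
  by apply/hasPn => x; rewrite mem_filter => /andP[].
have st : size t = 6%N.
  rewrite -[RHS](size_enum_ord 6); apply/perm_size/uniq_perm => //.
    exact: enum_uniq.
  move=> x; rewrite mem_cat mem_filter mem_enum andbT.
  by case: (x \in t3).
have inj : injective (fun l : 'I_(3 + 3) => nth i t l).
  by move=> a b /eqP; rewrite nth_uniq ?st // => /eqP/val_inj.
by exists (perm inj); rewrite !permE.
Qed.

(** General position of the six leaves, in dual form. *)
Lemma leaf_form_kernel A i j k (v : 'rV[F]_(3 + 3)) :
  nondegenerate_frames A -> i != j -> i != k -> j != k ->
  v *m leaf_form A i = 0 -> v *m leaf_form A j = 0 ->
  v *m leaf_form A k = 0 -> v = 0.
Proof.
move=> gA ij ik jk vi vj vk.
have [s [si sj sk]] := perm_of_triple ij ik jk.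
have [ub ut] := gA s; have uy := ybase_unit ub ut.
have vs l : v *m leaf_form A (s (lshift 3 l)) = 0.
  case: (unliftP 0 l) => [l1 ->|->]; last by rewrite si.
  case: (unliftP 0 l1) => [l2 ->|->]; last first.
    by rewrite -vj -sj; congr (_ *m leaf_form A (s (lshift 3 _))); apply: val_inj.
  rewrite -vk -sk; congr (_ *m leaf_form A (s (lshift 3 _))); apply: val_inj.
  by rewrite /= ord1.
have [xl yl] : (forall l, lsubmx v *m col (s (lshift 3 l)) (xframe A) = 0) /\
    (forall l, rsubmx v *m col (s (lshift 3 l)) (yframe A) = 0).
  split=> l; have := vs l; rewrite -{1}[v]hsubmxK mul_leaf_form -{1}[0]hsubmxK.
    by case/eq_row_mx => -> _; rewrite linear0.
  by case/eq_row_mx => _ ->; rewrite linear0.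
have x0 : lsubmx v = 0.
  apply: (can_inj (mulmxK ub)); rewrite mul0mx; apply/rowP => l.
  by have /rowP/(_ 0) := xl l; rewrite mul_col_lsubmx !mxE.
have y0 : rsubmx v = 0.
  apply: (can_inj (mulmxK uy)); rewrite mul0mx; apply/rowP => l.
  by have /rowP/(_ 0) := yl l; rewrite mul_col_lsubmx !mxE.
by rewrite -[v]hsubmxK x0 y0 row_mx0.
Qed.

Definition diag2 (a b : F) : 'M[F]_(1 + 1) := block_mx a%:M 0 0 b%:M.

Lemma leaf_form_top A s k : xbase A s \in unitmx -> xtop A s \in unitmx ->
  leaf_form A (s (rshift 3 k)) = \sum_(i < 3)
    leaf_form A (s (lshift 3 i)) *m diag2 (xcoeff A s i k) (ycoeff A s i k).
Proof.
move=> ub ut.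
have colE (U : 'M[F]_(3, 3 + 3)) (C : 'M[F]_3) : rsubmx (col_perm s U) =
    lsubmx (col_perm s U) *m C ->
    col (s (rshift 3 k)) U = \sum_(i < 3) col (s (lshift 3 i)) U *m (C i k)%:M.
  move=> /matrixP UC; apply/colP => r; have := UC r k; rewrite !mxE => ->.
  by rewrite summxE; apply: eq_bigr => i _; rewrite !mxE big_ord1 !mxE mulr1n.
rewrite /leaf_form (colE _ _ (xtop_xcoeff ub)) (colE _ _ (ytop_ycoeff ub ut)).
by rewrite !big_ord_recl !big_ord0 !addr0 !mulmx_block !add_block_mx
  !mulmx0 !mul0mx !addr0 !add0r.
Qed.

Lemma mul_diag2 (a b c d : F) :
  row_mx a%:M b%:M *m diag2 c d = row_mx (a * c)%:M (b * d)%:M :> 'rV[F]_(1 + 1).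
Proof. by rewrite mul_row_block !mulmx0 addr0 add0r -!scalar_mxM. Qed.

Lemma det_mx2 (M : 'M[F]_2) : \det M = M 0 0 * M 1 1 - M 0 1 * M 1 0.
Proof.
rewrite (expand_det_row _ 0) !big_ord_recl big_ord0 /cofactor !det_mx11 !mxE.
rewrite addr0 /= expr0 expr1 mul1r mulN1r mulrN.
by congr (M _ _ * M _ _ - M _ _ * M _ _); apply: val_inj.
Qed.

Lemma rank1_minor (E : 'M[F]_(3, 2)) : (\rank E <= 1)%N ->
  E 0 0 * E 1 1 = E 0 1 * E 1 0.
Proof.
move=> rE; pose f (l : 'I_2) : 'I_3 := widen_ord (leqnSn 2) l.
apply/eqP; rewrite -subr_eq0; apply/eqP.
have : \det (rowsub f E) = 0.
  apply/eqP; apply: contraTT rE => d0.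
  have u : rowsub f E \in unitmx by rewrite unitmxE unitfE.
  by rewrite -ltnNge; have := mxrankS (rowsub_sub f E); rewrite (mxrank_unit u).
rewrite det_mx2 !mxE => <-.
by congr (E _ _ * E _ _ - E _ _ * E _ _); apply: val_inj.
Qed.

(** The rows of 1%:M - M *m pinvmx M are in the kernel of M, hence in that
    of N. *)
Lemma factor_kernel m n p (M : 'M[F]_(m, n)) (N : 'M[F]_(m, p)) :
  (forall v : 'rV[F]_m, v *m M = 0 -> v *m N = 0) -> N = M *m (pinvmx M *m N).
Proof.
move=> h; apply/eqP; rewrite -subr_eq0 mulmxA -{1}[N]mul1mx -mulmxBl.
apply/eqP/row_matrixP => i; rewrite row_mul row0; apply: h.
by rewrite -row_mul mulmxBl mul1mx mulmxKpV // subrr row0.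
Qed.

End Generic.

(** * A generic renumbered matrix, from the cuspidal cubic *)

Section Witness.
Variable F : realFieldType.

Definition mx3 (a b c d e f g h i : F) : 'M[F]_3 := \matrix_(r, l)
  nth 0 (nth [::] [:: [:: a; b; c]; [:: d; e; f]; [:: g; h; i]] r) l.

Lemma det_mx3 (M : 'M[F]_3) : \det M =
  M 0 0 * (M 1 1 * M 2%:R 2%:R - M 1 2%:R * M 2%:R 1)
  - M 0 1 * (M 1 0 * M 2%:R 2%:R - M 1 2%:R * M 2%:R 0)
  + M 0 2%:R * (M 1 0 * M 2%:R 1 - M 1 1 * M 2%:R 0).
Proof.
rewrite (expand_det_row _ 0) !big_ord_recl big_ord0 /cofactor !det_mx2 !mxE.
rewrite addr0 /= expr0 expr1 mul1r mulN1r sqrrN expr1n mul1r mulrN addrA.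
by congr (M _ _ * (M _ _ * M _ _ - M _ _ * M _ _)
  - M _ _ * (M _ _ * M _ _ - M _ _ * M _ _)
  + M _ _ * (M _ _ * M _ _ - M _ _ * M _ _)); apply: val_inj.
Qed.

Definition cubic_points : 'M[F]_(3, 3 + 3) :=
  \matrix_(r, j) (j%:R) ^+ (nth 0%N [:: 0; 1; 3]%N r).

(** The minor at t_0, t_1, t_2 is the Vandermonde product times
    t_0 + t_1 + t_2, so it does not vanish for distinct nonnegative
    parameters. *)
Lemma cubic_minor (p : 'S_(3 + 3)) :
  lsubmx (col_perm p cubic_points) \in unitmx.
Proof.
pose t (i : 'I_3) : F := (p (lshift 3 i))%:R.
have neq i j : i != j -> t i != t j.
  move=> ij; rewrite eqr_nat; apply: contra ij => /eqP/val_inj/perm_inj.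
  by move/lshift_inj/eqP.
have t0 i : 0 <= t i by rewrite ler0n.
have -> : lsubmx (col_perm p cubic_points) =
    \matrix_(r, j) t j ^+ (nth 0%N [:: 0; 1; 3]%N r).
  by apply/matrixP => r j; rewrite !mxE.
rewrite unitmxE unitfE det_mx3 !mxE /=.
set d := (X in X != 0).
have -> : d = (t 1 - t 0) * (t 2%:R - t 0) * (t 2%:R - t 1) *
    (t 0 + t 1 + t 2%:R).
  by rewrite /d; ring.
rewrite !mulf_neq0 ?subr_eq0 ?neq //.
have := neq 0 1 isT; have := t0 0; have := t0 1; have := t0 2%:R.
by move=> *; rewrite gt_eqF //; lra.
Qed.

(** Permute the six points of the cubic by s^-1 and normalise the first three to
    the standard basis: this is (1 | A), and permuting it back by s gives, up to
    a linear map, the points in their original order.  The coefficient matrix at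
    s is therefore the same explicit matrix for every s. *)
Lemma exists_generic_at s : exists A : 'M[F]_3, generic_at A s.
Proof.
pose T := cubic_points; pose Z := col_perm s^-1 T.
have uT : lsubmx T \in unitmx by rewrite -[T]col_perm1 cubic_minor.
have uZ : lsubmx Z \in unitmx by exact: cubic_minor.
(* Coordinates of the points t = 3, 4, 5 over the points t = 0, 1, 2; its
   determinant is 4. *)
pose C := mx3 2 7 16 (-5) (-16) (-35) 4 10 20.
pose B := 4^-1 *: mx3 30 20 11 (-40) (-24) (-10) 14 8 3.
have TC : rsubmx T = lsubmx T *m C.
  apply/matrixP => i j; rewrite !mxE !big_ord_recl big_ord0 !mxE /=.
  case: i => [[|[|[|//]]] ?]; case: j => [[|[|[|//]]] ?] /=;
    rewrite /bump /= ?natrD; lra.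
have CB : C *m B = 1%:M.
  apply/matrixP => i j; rewrite !mxE !big_ord_recl big_ord0 !mxE /=.
  case: i => [[|[|[|//]]] ?]; case: j => [[|[|[|//]]] ?] /=; lra.
have [uC uB] := mulmx1_unit CB.
have CV : invmx C = B by rewrite -[B](mulKmx uC) CB mulmx1.
pose g := invmx (lsubmx Z); exists (g *m rsubmx Z).
have fE : col_perm s (xframe (g *m rsubmx Z)) = g *m T.
  rewrite /xframe -(mulVmx uZ) -/g -mul_mx_row hsubmxK /Z !col_permE.
  by rewrite -!mulmxA -perm_mxM invgK mulgV perm_mx1 mulmx1.
have bE : xbase (g *m rsubmx Z) s = g *m lsubmx T.
  by rewrite /xbase fE -[in LHS](hsubmxK T) mul_mx_row row_mxKl.
have tE : xtop (g *m rsubmx Z) s = g *m lsubmx T *m C.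
  by rewrite /xtop fE -[in LHS](hsubmxK T) mul_mx_row row_mxKr -mulmxA TC.
have ug : g *m lsubmx T \in unitmx by rewrite unitmx_mul unitmx_inv uZ.
have -> : generic_at (g *m rsubmx Z) s <-> defect C B != 0.
  rewrite /generic_at /xcoeff bE tE mulKmx // CV ug unitmx_mul ug uC.
  by split=> [[]|].
rewrite /defect !big_ord_recl big_ord0 !mxE /=.
clear; rewrite !mulf_neq0 ?invr_eq0 ?oppr_eq0 ?pnatr_eq0 ?oner_eq0 //.
by apply/eqP => h; lra.
Qed.

End Witness.

(** * Jacobians of linear maps and of pulled back submersions *)

Section Calculus.
Variable R : realType.

Definition id_chart n : chart R n 'rV[R]_n := Chart setT id id.

Lemma atlas_id n : @atlas R n (euclid R n) (id_chart n).
Proof. by []. Qed.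

Lemma atlas_euclidE n c : @atlas R n (euclid R n) c -> c = id_chart n.
Proof. by []. Qed.

Lemma Ck_cst m n k (S : set 'rV[R]_m) (w : 'rV[R]_n) : Ck k S (fun=> w).
Proof.
elim: k w => [|k IHk] w /=; first by move=> x _; exact: cst_continuous.
split=> [x _|v]; first exact: differentiable_cst.
have -> : (fun x : 'rV[R]_m => 'D_v (fun=> w) x) = (fun=> 0).
  by apply/funext => x; exact: derive_cst.
exact: IHk.
Qed.

Section Linear.
Variables (m n : nat) (L : 'M[R]_(m, n)).
Let f (p : 'rV[R]_m) : 'rV[R]_n := p *m L.

Lemma mulmx_continuous : continuous f.
Proof.
move=> p; rewrite /f.
have -> : (fun q : 'rV[R]_m => q *m L) = (fun q => \sum_i q 0 i *: row i L).
  by apply/funext => q; exact: mulmx_sum_row.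
apply: (cvg_big add_continuous (nbhs_filter p)) => i _.
apply: cvgZr_tmp; exact: coord_continuous.
Qed.

Lemma mulmx_differentiable p : differentiable f p.
Proof.
exact: (@linear_differentiable _ _ _ (mulmxr L) p mulmx_continuous).
Qed.

Lemma mulmx_derive p v : 'D_v f p = v *m L.
Proof.
rewrite deriveE; last exact: mulmx_differentiable.
by rewrite (@diff_lin _ _ _ (mulmxr L) p mulmx_continuous).
Qed.

Lemma mulmx_smooth (S : set 'rV[R]_m) : smooth_on S f.
Proof.
move=> [|k] /=; first by move=> x _; exact: mulmx_continuous.
split=> [x _|v]; first exact: mulmx_differentiable.
have -> : (fun x => 'D_v f x) = (fun=> v *m L).
  by apply/funext => x; exact: mulmx_derive.
exact: Ck_cst.
Qed.

End Linear.

Lemma jacobianP m n (f : 'rV[R]_m -> 'rV[R]_n) p (L : 'M[R]_(m, n)) :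
  differentiable f p -> (forall v, 'D_v f p = v *m L) -> jacobian f p = L.
Proof.
move=> df h; apply/row_matrixP => i.
by rewrite !rowE -deriveEjacobian // h.
Qed.

Lemma jacobian_mulmx m n (L : 'M[R]_(m, n)) p : jacobian (fun q => q *m L) p = L.
Proof.
by apply: jacobianP => [|v]; [exact: mulmx_differentiable|exact: mulmx_derive].
Qed.

Lemma jacobian_comp m n k (f : 'rV[R]_m -> 'rV[R]_n)
    (g : 'rV[R]_n -> 'rV[R]_k) p :
  differentiable f p -> differentiable g (f p) ->
  jacobian (g \o f) p = jacobian f p *m jacobian g (f p).
Proof.
move=> df dg; apply: jacobianP => [|v]; first exact: differentiable_comp.
rewrite deriveE; last exact: differentiable_comp.
by rewrite diff_comp //= mulmxA -!deriveEjacobian // !deriveE.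
Qed.

Lemma jacobian_near m n (f g : 'rV[R]_m -> 'rV[R]_n) p :
  differentiable f p -> differentiable g p ->
  (\forall q \near p, f q = g q) -> jacobian f p = jacobian g p.
Proof.
move=> df dg fg; apply: jacobianP => // v.
by rewrite -deriveEjacobian //; exact: near_eq_derive.
Qed.

Lemma smooth_map_differentiable m n (M : manifold R m) (N : manifold R n)
    (U : set M) (phi : M -> N) (c : chart R m M) (c' : chart R n N) p :
  smooth_map U phi -> atlas c -> atlas c' ->
  U p -> chart_dom c p -> chart_dom c' (phi p) ->
  differentiable (chart_to c' \o phi \o chart_from c) (chart_to c p).
Proof.
move=> [_ sm] ac ac' Up cp c'p; have [+ _] := sm c c' ac ac' 1%N; apply.
by exists p.
Qed.

Lemma mulmx_smooth_map m n (L : 'M[R]_(m, n)) (S : set (euclid R m)) :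
  @smooth_map R m n (euclid R m) (euclid R n) S (fun q => q *m L).
Proof.
split=> [p _|c c' /atlas_euclidE -> /atlas_euclidE ->].
  exact: mulmx_continuous.
exact: mulmx_smooth.
Qed.

(** Near p the linear submersion is h \o g \o phi with h a local diffeomorphism
    of the plane; the chart c' is inserted between g and phi, and the matrix H
    is the Jacobian of h. *)
Lemma pulled_back_jacobian (N : manifold R 6) (U : set (euclid R 6))
    (phi : euclid R 6 -> N) (c' : chart R 6 N) (p : euclid R 6)
    (V : set N) (g : N -> euclid R 2) (L : 'M[R]_(6, 2)) W :
  smooth_map U phi -> U p -> atlas c' -> chart_dom c' (phi p) ->
  smooth_map V g -> V (phi p) -> W p ->
  @same_leaves R (euclid R 6) W (fun q => q *m L) (g \o phi) ->
  exists H, L = jacobian (chart_to c' \o phi) p *m chart_diff c' g (phi p) *m H.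
Proof.
move=> sphi Up ac' c'p sg Vp Wp /(_ p Wp)[N2 [h [N2p [psi [oN2 _ sh _ _]] fE]]].
exists (jacobian h (g (phi p))).
have dphi : differentiable (chart_to c' \o phi) p.
  exact: (smooth_map_differentiable sphi (atlas_id 6) ac' Up _ c'p).
have [_ _ fromK _ _] := atlas_homeo ac'.
have dg : differentiable (g \o chart_from c') ((chart_to c' \o phi) p).
  exact: (smooth_map_differentiable sg ac' (atlas_id 2) Vp c'p).
have dh : differentiable h ((g \o chart_from c') ((chart_to c' \o phi) p)).
  rewrite /= fromK //.
  exact: (smooth_map_differentiable sh (atlas_id 2) (atlas_id 2) N2p).
rewrite -[LHS](jacobian_mulmx L p).
have dhg := differentiable_comp dg dh.
have e : g (phi p) = (g \o chart_from c') ((chart_to c' \o phi) p).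
  by rewrite /= fromK.
rewrite e -mulmxA -[chart_diff _ _ _ *m _](jacobian_comp dg dh).
rewrite -(jacobian_comp dphi dhg).
apply: jacobian_near; first exact: mulmx_differentiable.
  exact: differentiable_comp.
have [odom _ _ _ _] := atlas_homeo ac'.
have near_dom : \forall q \near p, chart_dom c' (phi q).
  by apply: (sphi.1 p Up); apply: open_nbhs_nbhs.
near=> q; have qE : q *m L = h (g (phi q)) by near: q.
by rewrite qE /= fromK //; near: q.
Unshelve. all: by end_near.
Qed.

End Calculus.

(** * Segre cones in one tangent space *)

Section Cones.
Variable R : realType.

Lemma annihilator_mul (T : set 'rV[R]_6) (M : 'M[R]_(6, 2)) K :
  (forall v, T v <-> v *m M = 0) -> \rank M = 2%N -> K \in unitmx ->
  annihilator_basis T (M *m K).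
Proof.
move=> TM rM uK; split; first by rewrite mxrankMfree // row_free_unit.
move=> v; rewrite TM mulmxA; split=> [->|]; first by rewrite mul0mx.
by move/(congr1 (mulmx^~ (invmx K))); rewrite mulmxK // mul0mx.
Qed.

Lemma diag2_unit (a b : R) : a != 0 -> b != 0 -> diag2 a b \in unitmx.
Proof.
move=> a0 b0; have : diag2 a b *m diag2 a^-1 b^-1 = 1%:M.
  rewrite mulmx_block !mulmx0 !mul0mx !addr0 !add0r -!scalar_mxM !mulfV //.
  by rewrite -scalar_mx_block.
by case/mulmx1_unit.
Qed.

(** What a web equivalent to the linear one provides at a point: form matrices M
    of the six leaves, with the relations of the linear web among them. *)
Variables (N : manifold R 6) (F : 'I_6 -> set (local_leaves N)).
Variables (c : chart R 6 N) (p : N).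
Variables (M : 'I_(3 + 3) -> 'M[R]_(6, 2)) (C D : 'M[R]_3).
Hypothesis tangentE : forall xi v, tangent_plane (F xi) c p v <-> v *m M xi = 0.
Hypothesis rankM : forall xi, \rank (M xi) = 2%N.
Hypothesis dualM : forall z : 'I_3 -> 'rV[R]_(1 + 1),
  exists v, forall i, v *m M (lshift 3 i) = z i.
Hypothesis topM : forall k, M (rshift 3 k) =
  \sum_(i < 3) M (lshift 3 i) *m diag2 (C i k) (D i k).

Let rank_at k (v : 'rV[R]_6) := \rank (\matrix_(i < 3, j < 2)
  (v *m (M (lshift 3 i) *m diag2 (C i k) (D i k))) 0 j)%R.

Lemma segre_coneI k v : (forall i, C i k != 0) -> (forall i, D i k != 0) ->
  (rank_at k v <= 1)%N -> segre_cone F k c p v.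
Proof.
move=> C0 D0 rv; exists (fun i => M (lshift 3 i) *m diag2 (C i k) (D i k)).
exists (M (rshift 3 k) *m - 1%:M); split=> //.
- by move=> i; apply: annihilator_mul => //; exact: diag2_unit.
- by apply: annihilator_mul => //; rewrite -scaleN1r unitmxZ ?unitmx1 // unitrN1.
- by rewrite mulmxN mulmx1 opprK topM.
Qed.

(** Write the basis chosen for the fourth plane as Oa = M (rshift 3 k) *m K.
    Independence of the first three conormal planes then forces
    Om i = - M (lshift 3 i) *m diag2 (C i k) (D i k) *m K, so the choices only
    multiply the matrix of the cone by the invertible - K. *)
Lemma segre_coneE k v : segre_cone F k c p v -> (rank_at k v <= 1)%N.
Proof.
case=> Om [Oa [hOm [rOa hOa] sumO rv]].
have kerE xi O : annihilator_basis (tangent_plane (F xi) c p) O ->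
    O = M xi *m (pinvmx (M xi) *m O).
  by case=> _ h; apply: factor_kernel => w /tangentE/h.
pose K := pinvmx (M (rshift 3 k)) *m Oa.
have OaE : Oa = M (rshift 3 k) *m K by exact: kerE.
have uK : K \in unitmx.
  rewrite -row_free_unit /row_free eqn_leq rank_leq_row /= -{1}rOa OaE.
  exact: mxrankM_maxr.
pose Ki i := pinvmx (M (lshift 3 i)) *m Om i.
have OmE i : Om i = M (lshift 3 i) *m Ki i by exact: kerE.
have sum0 :
    \sum_(i < 3) M (lshift 3 i) *m (diag2 (C i k) (D i k) *m K + Ki i) = 0.
  under eq_bigr => i _ do rewrite mulmxDr -OmE mulmxA.
  by rewrite big_split /= -mulmx_suml -topM -OaE -sumO addrN.
have KiE i : Ki i = - (diag2 (C i k) (D i k) *m K).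
  apply/eqP; rewrite -addr_eq0 addrC; apply/eqP/row_matrixP => j.
  have [w wE] := dualM (fun l => if l == i then delta_mx 0 j else 0).
  have := congr1 (mulmx w) sum0; rewrite mulmx0 mulmx_sumr (bigD1 i) //=.
  rewrite big1 => [|l /negPf li]; last by rewrite mulmxA wE li mul0mx.
  by rewrite addr0 mulmxA wE eqxx -rowE row0.
move: rv; rewrite /rank_at; set E := \matrix_(i, j) _; set E0 := \matrix_(i, j) _.
have -> : E = - (E0 *m K).
  apply/row_matrixP => i; rewrite linearN /= row_mul.
  have -> : row i E = v *m Om i by apply/rowP => j; rewrite !mxE.
  have -> : row i E0 = v *m (M (lshift 3 i) *m diag2 (C i k) (D i k)).
    by apply/rowP => j; rewrite !mxE.
  by rewrite OmE KiE mulmxN mulmxN !mulmxA.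
by rewrite mxrank_opp mxrankMfree // row_free_unit.
Qed.

(** The test vector is v with u_i(v) = D i k and w_i(v) = C i k.  Its matrix for
    the cone k has two equal columns; the conclusion is the vanishing of the
    first minor of its matrix for the cone l. *)
Lemma segre_cone_eq (k l : 'I_3) :
  (forall i, C i k != 0) -> (forall i, D i k != 0) ->
  segre_cone F k c p = segre_cone F l c p ->
  D 0 k * C 0 l * (C 1 k * D 1 l) = C 0 k * D 0 l * (D 1 k * C 1 l).
Proof.
move=> Ck Dk eqkl.
have [v vE] := dualM (fun i => row_mx (D i k)%:M (C i k)%:M).
have vM i m : v *m (M (lshift 3 i) *m diag2 (C i m) (D i m)) =
    row_mx (D i k * C i m)%:M (C i k * D i m)%:M.
  by rewrite mulmxA vE mul_diag2.
have vk : segre_cone F k c p v.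
  apply: segre_coneI => //; rewrite /rank_at.
  have -> : \matrix_(i < 3, j < 2)
      (v *m (M (lshift 3 i) *m diag2 (C i k) (D i k))) 0 j =
      (\col_i (C i k * D i k)) *m (const_mx 1 : 'rV_(1 + 1)).
    apply/matrixP => i j; rewrite mxE vM [RHS]mxE big_ord1 !mxE mulr1.
    by case: (@split_ordP 1 1 j) => j' _; rewrite mxE ord1 mulr1n // mulrC.
  exact: leq_trans (mxrankM_maxl _ _) (rank_leq_col _).
move: vk; rewrite eqkl => /segre_coneE/rank1_minor.
have j0 : 0 = lshift 1 (0 : 'I_1) :> 'I_(1 + 1) by exact: val_inj.
have j1 : 1 = rshift 1 (0 : 'I_1) :> 'I_(1 + 1) by exact: val_inj.
rewrite ![(\matrix_(i, j) _) _ _]mxE !vM.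
by rewrite j0 j1 !row_mxEl !row_mxEr !mxE !mulr1n.
Qed.

End Cones.

(** * The linear web *)

Section LinearWeb.
Variables (R : realType) (A : 'M[R]_3).

Lemma linear_webE (xi : 'I_(3 + 3)) (q : euclid R 6) :
  \row_(j < 2) (if j == 0 then web_x A xi q else web_y A xi q) =
  (q : 'rV[R]_(3 + 3)) *m leaf_form A xi.
Proof.
have xE : lsubmx (q : 'rV[R]_(3 + 3)) *m col xi (xframe A) = (web_x A xi q)%:M.
  rewrite colEsub mulmx_colsub /xframe mul_mx_row mulmx1 /web_x.
  apply/rowP => j; rewrite ord1 !mxE.
  case: (@split_ordP 3 3 xi) => i _; rewrite !mxE mulr1n //.
  by apply: eq_bigr => l _; rewrite mxE mulrC.
have yE : rsubmx (q : 'rV[R]_(3 + 3)) *m col xi (yframe A) = (web_y A xi q)%:M.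
  rewrite colEsub mulmx_colsub /yframe mul_mx_row mulmx1 /web_y.
  apply/rowP => j; rewrite ord1 !mxE.
  case: (@split_ordP 3 3 xi) => i _; rewrite !mxE mulr1n //.
  by rewrite -sumrN; apply: eq_bigr => l _; rewrite !mxE mulrN mulrC.
rewrite -[X in _ = X *m _](@hsubmxK _ _ 3 3) mul_leaf_form xE yE.
apply/rowP => j; rewrite mxE.
have [j' -> | j' ->] := @split_ordP 1 1 j; rewrite ord1 /=.
  by apply/esym/(etrans (row_mxEl _ _ _ _)); rewrite mxE mulr1n.
by apply/esym/(etrans (row_mxEr _ _ _ _)); rewrite mxE mulr1n.
Qed.

Lemma linear_web_leaf xi U f : linear_web A xi (U, f) ->
  U = setT /\ f = fun q : 'rV[R]_(3 + 3) => q *m leaf_form A xi.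
Proof. by case=> -> ->; split=> //; apply/funext => q; exact: linear_webE. Qed.

Lemma linear_web_tangent xi (p : euclid R 6) v :
  tangent_plane (linear_web A xi) (id_chart R 6) p v <->
  (v : 'rV[R]_(3 + 3)) *m leaf_form A xi = 0.
Proof.
have dE : @chart_diff R (euclid R 6) (id_chart R 6)
    (fun q : 'rV[R]_(3 + 3) => q *m leaf_form A xi) p = leaf_form A xi.
  exact: jacobian_mulmx.
split=> [[U [f [/linear_web_leaf[_ ->] _]]]|h]; first by rewrite dE.
exists setT, (fun q => \row_(j < 2)
  (if j == 0 then web_x A xi q else web_y A xi q)); split=> //.
by rewrite (_ : (fun q : euclid R 6 => _) =
  fun q : 'rV[R]_(3 + 3) => q *m leaf_form A xi) ?dE //;
  apply/funext => q; exact: linear_webE.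
Qed.

Lemma diffeo_id n : diffeo (M := euclid R n) (N := euclid R n) setT id.
Proof.
have sid (U : set (euclid R n)) : smooth_map (N := euclid R n) U id.
  have -> : id = (fun q : euclid R n => (q : 'rV[R]_n) *m 1%:M).
    by apply/funext => q; rewrite mulmx1.
  exact: mulmx_smooth_map.
by exists id; split=> //; rewrite ?image_id; exact: openT.
Qed.

(** Bases of conormal planes are arbitrary in the definition of general position,
    so this goes through the kernels, which do not depend on them. *)
Lemma linear_web_web :
  nondegenerate_frames A -> web [set: euclid R 6] (linear_web A).
Proof.
move=> gA; split; first exact: openT.
- move=> xi; split.
  + move=> U f /linear_web_leaf[-> ->]; split; [exact: openT|exact: subsetT|].
    split; first exact: mulmx_smooth_map.
    move=> c p /atlas_euclidE -> _ _.
    by rewrite /chart_diff jacobian_mulmx leaf_form_rank.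
  + by move=> p _; exists setT, (fun q => \row_(j < 2)
      (if j == 0 then web_x A xi q else web_y A xi q)); split; first exact: erefl.
  + move=> U f V g /linear_web_leaf[_ ->] /linear_web_leaf[_ ->] p _.
    exists setT, id; split=> //; first exact: diffeo_id.
    by apply: filterE.
- move=> c p /atlas_euclidE -> _ _ i j k ij ik jk Oi Oj Ok [_ hi] [_ hj] [_ hk].
  apply/eqP; rewrite -[_ == _]/(row_free _); apply: inj_row_free => v.
  rewrite !mul_mx_row => /eqP; rewrite !row_mx_eq0.
  case/and3P=> /eqP/hi vi /eqP/hj vj /eqP/hk vk.
  have tE xi := (linear_web_tangent xi p v).1.
  exact: leaf_form_kernel gA ij ik jk (tE i vi) (tE j vj) (tE k vk).
Qed.

(** In a chart around phi p, the conormal planes of the other web are spanned by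
    the columns of Phi^-1 *m leaf_form A xi, and the first two of its three
    cones already differ. *)
Lemma not_almost_grassmannizable : (forall s, generic_at A s) ->
  ~ almost_grassmannizable [set: euclid R 6] (linear_web A).
Proof.
move=> gA [N [D' [F' [[_ folF _] agF [U [phi [s [[p Up] _ UD' dphi carF]]]]]]]].
have nA : nondegenerate_frames A by move=> t; have [] := gA t.
have [_ [_ _ sphi _ _]] := dphi.
have Dp : D' (phi p) by apply: UD'; exists p.
have [c' ac' c'p] := atlas_cover (phi p).
pose Phi : 'M[R]_(3 + 3) := jacobian (chart_to c' \o phi) p.
have pull xi V g : F' (s xi) (V, g) -> V (phi p) ->
    exists H, leaf_form A xi = Phi *m chart_diff c' g (phi p) *m H.
  move=> Fg Vp; have [leafF _ _] := folF (s xi).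
  have [_ _ [sg _]] := leafF _ _ Fg.
  pose f (q : euclid R 6) : euclid R 2 :=
    \row_(j < 2) (if j == 0 then web_x A xi q else web_y A xi q).
  have := carF xi setT f V g erefl Fg.
  rewrite (_ : f = fun q : 'rV[R]_(3 + 3) => q *m leaf_form A xi); last first.
    by apply/funext => q; exact: linear_webE.
  by apply: (pulled_back_jacobian sphi Up ac' c'p sg Vp); split.
have leaf xi : exists V g, F' (s xi) (V, g) /\ V (phi p).
  by have [_ coverF _] := folF (s xi); exact: coverF.
have uPhi : Phi \in unitmx.
  rewrite -row_free_unit; apply: inj_row_free => v v0.
  have h xi : v *m leaf_form A xi = 0.
    have [V [g [Fg Vp]]] := leaf xi; have [H ->] := pull xi V g Fg Vp.
    by rewrite !mulmxA v0 !mul0mx.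
  exact: (leaf_form_kernel (i := 0) (j := 1) (k := 2%:R) nA).
(* Foliation xi of the other web is the image of foliation s^-1 xi. *)
pose t := (s^-1)%g : 'S_(3 + 3).
pose M xi := invmx Phi *m leaf_form A (t xi).
have [ub ut dC] := gA t.
have tangentE xi v : tangent_plane (F' xi) c' (phi p) v <-> v *m M xi = 0.
  have {1}-> : xi = s (t xi) by rewrite permKV.
  rewrite /M; move: {xi}(t xi) => xi.
  have key V g : F' (s xi) (V, g) -> V (phi p) ->
      v *m chart_diff c' g (phi p) = 0 <->
      v *m (invmx Phi *m leaf_form A xi) = 0.
    move=> Fg Vp; have [H HE] := pull xi V g Fg Vp.
    have uH : H \in unitmx.
      rewrite -row_free_unit /row_free eqn_leq rank_leq_row /=.
      by rewrite -{1}(leaf_form_rank xi nA) HE mxrankM_maxr.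
    rewrite HE -mulmxA mulKmx // mulmxA; split=> [->|]; first by rewrite mul0mx.
    by move/(congr1 (mulmx^~ (invmx H))); rewrite mulmxK // mul0mx.
  split=> [[V [g [Fg Vp]]] /(key _ _ Fg Vp) //|h].
  have [V [g [Fg Vp]]] := leaf xi.
  by exists V, g; split=> //; apply/(key _ _ Fg Vp).
have rankM xi : \rank (M xi) = 2%N.
  by rewrite /M eqmxMfull ?row_full_unit ?unitmx_inv // leaf_form_rank.
have dualM (z : 'I_3 -> 'rV[R]_(1 + 1)) :
    exists v, forall i, v *m M (lshift 3 i) = z i.
  have [v vE] := leaf_form_dual z ub ut.
  by exists (v *m Phi) => i; rewrite /M mulmxA mulmxK.
have topM k : M (rshift 3 k) = \sum_(i < 3)
    M (lshift 3 i) *m diag2 (xcoeff A t i k) (ycoeff A t i k).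
  rewrite /M leaf_form_top // mulmx_sumr; apply: eq_bigr => i _; exact: mulmxA.
have := segre_cone_eq tangentE rankM dualM topM (k := 0) (l := 1).
move: dC; rewrite /defect mulf_eq0 negb_or => /andP[/prodf_neq0 C0 d0].
have yE i k : ycoeff A t i k = - invmx (xcoeff A t) k i by rewrite 2!mxE.
have Ci i : xcoeff A t i 0 != 0.
  by have := C0 i isT; rewrite mulf_eq0 negb_or => /andP[].
have Di i : ycoeff A t i 0 != 0.
  by have := C0 i isT; rewrite yE oppr_eq0 mulf_eq0 negb_or => /andP[].
move=> /(_ Ci Di (agF c' (phi p) ac' Dp c'p 0 1)) /eqP; apply/negP.
rewrite -subr_eq0 !yE; apply: contra d0.
move: (xcoeff A t) (invmx _) => C B /eqP e0; apply/eqP.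
by rewrite -[RHS]e0; ring.
Qed.

End LinearWeb.

Theorem theorem2 (R : realType) :
  exists P : mpoly.mpoly (3 * 3)%N R,
    P != 0 /\
    forall A : 'M[R]_3, A \in unitmx ->
      mpoly.meval (fun k : 'I_(3 * 3) => mxvec A 0 k) P != 0 ->
      web [set: euclid R 6] (linear_web A) /\
      ~ almost_grassmannizable [set: euclid R 6] (linear_web A).
Proof.
pose X : 'M[mpoly.mpoly (3 * 3) R]_3 :=
  vec_mx (\row_k mpoly.mpolyX R (mpoly.mnm1 k)).
have evalX (A : 'M[R]_3) :
    map_mx (mpoly.meval (fun k => mxvec A 0 k)) X = A.
  rewrite /X map_vec_mx -[RHS]mxvecK; congr vec_mx.
  by apply/rowP => k; rewrite !mxE mpoly.mevalXU.
have evalP (A : 'M[R]_3) s :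
    mpoly.meval (fun k => mxvec A 0 k) (genericity_at X s) = genericity_at A s.
  by rewrite -map_genericity_at evalX.
exists (\prod_(s : 'S_(3 + 3)) genericity_at X s); split.
  apply/prodf_neq0 => s _; have [A /genericity_atP] := exists_generic_at R s.
  by rewrite -evalP; apply: contra_neq => ->; rewrite raddf0.
move=> A _; rewrite rmorph_prod => /prodf_neq0 hA.
have gA s : generic_at A s by apply/genericity_atP; rewrite -evalP hA.
split; last exact: not_almost_grassmannizable.
by apply: linear_web_web => s; have [] := gA s.
Qed.
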